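(* Let $q\in(-1,1)$, $|q|<t\le 1$ and $\lambda>0$, and let $\xi$ be a unit vector spanning the one-dimensional real Hilbert space $\mathscr{H}=\mathbb{R}\xi$. Let $\boldsymbol{p}^{\lambda}_{q,t}=N_{q,t}+\sqrt{\lambda}\,(A_{q,t}^{\dagger}+A_{q,t})+\lambda\boldsymbol{1}$ be the $(q,t)$-Poisson type operator on the one-mode $(q,t)$-Fock space $\mathcal{F}_{q,t}(\mathscr{H})$ with vacuum vector $\Omega$, and let $C_n(x)=C_n^{(q,t)}(\lambda;x)$ be the $(q,t)$-Charlier polynomials. Then $$C_{n}(\boldsymbol{p}^{\lambda}_{q,t})\,\Omega=\sqrt{\lambda^{n}}\;\xi^{\otimes n},\qquad n\ge 0 .$$ Consequently, the probability distribution of $\boldsymbol{p}^{\lambda}_{q,t}$ with respect to the vacuum expectation $\varphi(b)=(b\,\Omega\,|\,\Omega)_{q,t}$ is the $(q,t)$-Poisson distribution $\mu^{\lambda}_{q,t}$ of parameter $\lambda$; that is, $\varphi\big(P(\boldsymbol{p}^{\lambda}_{q,t})\big)=\int_{\mathbb{R}}P(x)\,d\mu^{\lambda}_{q,t}(x)$ for every polynomial $P\in\mathbb{C}[x]$.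
   Context: **$(q,t)$-numbers.** For $q\in(-1,1)$, $|q|<t\le1$, put $[n]_{q,t}=\frac{t^n-q^n}{t-q}=\sum_{k=1}^{n}t^{n-k}q^{k-1}$ for $n\ge1$, and $[0]_{q,t}=0$. **$(q,t)$-Fock space.** Let $\mathscr{H}$ be a real Hilbert space with inner product $\langle\cdot|\cdot\rangle$, and let $\mathcal{F}_{\mathrm{fin}}(\mathscr{H})$ be the complex vector space of finite linear combinations of elementary tensors $\xi_1\otimes\cdots\otimes\xi_n\in\mathscr{H}^{\otimes n}$, $n\ge0$, where $\mathscr{H}^{\otimes0}=\mathbb{C}\Omega$ with $\Omega$ a unit vector (the vacuum). The $(q,t)$-inner product is $$(\xi_1\otimes\cdots\otimes\xi_n\,|\,\eta_1\otimes\cdots\otimes\eta_m)_{q,t}=\delta_{m,n}\,t^{n(n-1)/2}\sum_{\sigma\in\mathfrak{S}_n}(q/t)^{i(\sigma)}\langle\xi_1|\eta_{\sigma(1)}\rangle\cdots\langle\xi_n|\eta_{\sigma(n)}\rangle,$$ where $i(\sigma)$ is the number of inversions of $\sigma$. It is positive definite, and $\mathcal{F}_{q,t}(\mathscr{H})$ is the completion of $\mathcal{F}_{\mathrm{fin}}(\mathscr{H})$ with respect to it. The one-mode case is $\mathscr{H}=\mathbb{R}\xi$ with $\|\xi\|=1$; then the vectors $\xi^{\otimes n}$, $n\ge0$ (with $\xi^{\otimes0}=\Omega$) are orthogonal and span a dense subspace. **Operators (one-mode).** The $(q,t)$-creation operator is given by $A_{q,t}^{\dagger}\xi^{\otimes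 n}=\xi^{\otimes(n+1)}$, $n\ge0$. The $(q,t)$-annihilation operator $A_{q,t}$ is the adjoint of $A_{q,t}^{\dagger}$ with respect to $(\cdot|\cdot)_{q,t}$; it acts by $A_{q,t}\Omega=0$ and $A_{q,t}\xi^{\otimes n}=[n]_{q,t}\xi^{\otimes(n-1)}$, $n\ge1$. The $(q,t)$-number operator is $N_{q,t}=A_{q,t}^{\dagger}A_{q,t}$. $\boldsymbol{1}$ denotes the identity operator. These operators are bounded and $\boldsymbol{p}^{\lambda}_{q,t}$ is self-adjoint. **$(q,t)$-Charlier polynomials and $(q,t)$-Poisson distribution.** The polynomials $C_n(x)=C^{(q,t)}_n(\lambda;x)$ are defined by $C_0(x)=1$, $C_1(x)=x-\lambda$, and $$C_{n+1}(x)=\big(x-(\lambda+[n]_{q,t})\big)C_n(x)-\lambda[n]_{q,t}\,C_{n-1}(x),\qquad n\ge1 .$$ The $(q,t)$-Poisson distribution $\mu^{\lambda}_{q,t}$ is the probability measure on $\mathbb{R}$ with respect to which the sequence $\{C_n\}_{n\ge0}$ is orthogonal (it exists by Favard's theorem and is unique since the recurrence coefficients are bounded). *)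

(* Defs.v *)
From mathcomp Require Import all_boot all_order all_algebra.
From mathcomp Require Import perm sesquilinear.
From mathcomp Require Import complex.
From mathcomp Require Import all_classical all_reals all_analysis.

Set Implicit Arguments.
Unset Strict Implicit.
Unset Printing Implicit Defensive.

Import Order.TTheory GRing.Theory Num.Theory.
Import numFieldNormedType.Exports.

Local Open Scope classical_set_scope.
Local Open Scope complex_scope.
Local Open Scope ring_scope.

Definition qt_number {R : realType} (q t : R) (n : nat) : R :=
  (t ^+ n - q ^+ n) / (t - q).

Definition inversions (n : nat) (s : 'S_n) : nat :=
  #|[pred p : 'I_n * 'I_n | (p.1 < p.2)%N && (s p.2 < s p.1)%N]|.

(* The norm of [V] is the one given by the inner product [dot]; as [V] is
   complete, [(V, dot)] is then a Hilbert space (real for [theta = idfun],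
   complex for [theta = Num.conj]). *)
Definition hilbert_norm {K : numFieldType} {theta : K -> K}
    {V : completeNormedModType K} (dot : {dot V for theta}) : Prop :=
  forall x : V, dot x x = `|x| ^+ 2.

(* A sequence [s] of vectors stands for the elementary tensor of its entries. *)
Definition qt_inner {R : realType} (q t : R) {H : completeNormedModType R}
    (dotH : {dot H for idfun}) (s u : seq H) : R :=
  (size s == size u)%:R *
  (t ^+ (size s * (size s).-1)./2 *
   \sum_(sigma : 'S_(size s)) (q / t) ^+ inversions sigma *
     \prod_(i < size s) dotH s`_i u`_(sigma i)).

Definition lin_span {K : numFieldType} {V : normedModType K} (S : set V) :
    set V :=
  [set x | exists2 r : seq (K * V), (forall p, p \in r -> S p.2) &
                                    x = \sum_(p <- r) p.1 *: p.2].

(* A completion of the complex span of the elementary tensors over [H] for the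
   (q,t)-inner product, i.e. a complex Hilbert space with a dense image of
   that span and the prescribed inner products of elementary tensors; this
   determines it up to a unique unitary isomorphism. Real multilinearity of
   [tensor] needs no separate clause: by [tensor_dot] and bilinearity of
   [dotH], the vectors expressing it have norm 0. *)
Record qt_fock_space {R : realType} (q t : R) {H : completeNormedModType R}
    (dotH : {dot H for idfun}) := QtFockSpace {
  fock_carrier :> completeNormedModType R[i];
  fock_dot : {dot fock_carrier for (@Num.conj R[i])};
  fock_hilbert : hilbert_norm fock_dot;
  tensor : seq H -> fock_carrier;
  tensor_dot : forall s u : seq H,
    fock_dot (tensor s) (tensor u) = (qt_inner q t dotH s u)%:C;
  tensor_dense : dense (lin_span (range tensor))
}.

Section FockOperators.
Context {R : realType} {q t : R} {H : completeNormedModType R}.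
Context {dotH : {dot H for idfun}} (F : qt_fock_space q t dotH).

Definition vacuum : F := tensor F [::].

Definition tensor_power (xi : H) (n : nat) : F := tensor F (nseq n xi).

Definition vacuum_expectation (b : F -> F) : R[i] :=
  fock_dot F (b vacuum) vacuum.

Definition is_creation (xi : H) (Adag : {linear F -> F}) : Prop :=
  continuous Adag /\
  forall n, Adag (tensor_power xi n) = tensor_power xi n.+1.

Definition is_adjoint (T S : F -> F) : Prop :=
  forall x y : F, fock_dot F (S x) y = fock_dot F x (T y).

Definition qt_number_op (Adag A : F -> F) : F -> F := Adag \o A.

Definition qt_poisson_op (lam : R) (Adag A : F -> F) : F -> F := fun x =>
  qt_number_op Adag A x + (Num.sqrt lam)%:C *: (Adag x + A x) + lam%:C *: x.

Definition poly_op (P : {poly R[i]}) (T : F -> F) : F -> F := fun x =>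
  \sum_(i < size P) P`_i *: iter i T x.

End FockOperators.

Fixpoint qt_charlier {R : realType} (q t lam : R) (n : nat) : {poly R} :=
  match n with
  | 0 => 1
  | n'.+1 =>
    match n' with
    | 0 => 'X - lam%:P
    | n''.+1 =>
        ('X - (lam + qt_number q t n')%:P) * qt_charlier q t lam n'
        - (lam * qt_number q t n') *: qt_charlier q t lam n''
    end
  end.

(* The moments are required to be finite so that the orthogonality integrals
   are genuine. *)
Definition is_qt_poisson {R : realType} (q t lam : R)
    (mu : probability (measurableTypeR R) R) : Prop :=
  (forall n : nat, mu.-integrable setT (fun x : R => (x ^+ n)%:E)) /\
  (forall m n : nat, m != n ->
     (\int[mu]_x ((qt_charlier q t lam m).[x] * (qt_charlier q t lam n).[x])
      = 0)%R).

Definition complex_integral {R : realType}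
    (mu : probability (measurableTypeR R) R) (f : R -> R[i]) : R[i] :=
  Complex (\int[mu]_x complex.Re (f x))%R (\int[mu]_x complex.Im (f x))%R.

(* Main.v *)
(* Splitting a permutation of n+1 points according to the image of the first
   point shows that the squared norm of xi^(n+1) is [n+1]_(q,t) times that of
   xi^n; by adjointness and density of the tensors, A xi^n = [n]_(q,t) xi^(n-1).
   Hence p acts on the tensor powers by the Charlier recurrence, rescaled by
   powers of sqrt(lambda), which gives C_n(p) Omega = sqrt(lambda)^n xi^n.
   Therefore P |-> phi(P(p)) and P |-> int P dmu both send C_0 to 1 and C_n to 0
   for n > 0; the C_n being a basis of the polynomials, they agree. *)
From HB Require Import structures.
Require Import Defs.
From mathcomp Require Import all_boot all_order all_algebra.
From mathcomp Require Import perm sesquilinear.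
From mathcomp Require Import complex.
From mathcomp Require Import all_classical all_reals all_analysis.
From mathcomp Require Import ring.
Import Order.TTheory GRing.Theory Num.Theory.
Import numFieldNormedType.Exports.
Local Open Scope complex_scope.
Local Open Scope ring_scope.

(** * Inversions of permutations and their generating function *)

Lemma inversionsE n (s : 'S_n) :
  inversions s = (\sum_(i < n) \sum_(j < n) ((i < j) && (s j < s i)))%N.
Proof.
rewrite /inversions -sum1_card pair_big /= big_mkcond /=.
by apply: eq_bigr => p _; rewrite unfold_in /=; case: ifP.
Qed.

(** The first point, sent to [j], is inverted with exactly the [j] points whose images lie below
    [j]. Pairs of other points keep their order, since [lift j] is increasing. *)
Lemma inversions_lift_perm n (j : 'I_n.+1) (s : 'S_n) :
  inversions (lift_perm ord0 j s) = (j + inversions s)%N.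
Proof.
rewrite !inversionsE big_ord_recl; congr (_ + _)%N.
  rewrite big_ord_recl /= add0n lift_perm_id.
  under eq_bigr => k _ do rewrite lift_perm_lift.
  rewrite -(reindex_inj (P := xpredT) (F := fun k => (lift j k < j) : nat)
              (@perm_inj _ s)) /=.
  have jn : (j <= n)%N by rewrite -ltnS.
  (* [lift j] fixes [k] when [k < j] and otherwise moves it to [k.+1], above [j]. *)
  transitivity (\sum_(k < n | (k < j)%N) 1)%N.
    rewrite [RHS]big_mkcond; apply: eq_bigr => k _.
    by rewrite /bump; case: (leqP j k) => jk;
      rewrite ?add1n ?add0n ?jk // ltnNge (leq_trans jk).
  by rewrite big_ord_narrow // sum1_card card_ord.
apply: eq_bigr => i _; rewrite big_ord_recl /= add0n.
apply: eq_bigr => k _; rewrite !lift_perm_lift /=.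
by rewrite !ltnNge !leq_bump2 negbK.
Qed.

(** The image of [ord0] recovers [j], and cancelling [lift j] recovers [s]; the cardinalities agree
    by (n+1) n! = (n+1)!. *)
Lemma lift_perm_bij n :
  bijective (fun p : 'I_n.+1 * 'S_n => lift_perm ord0 p.1 p.2).
Proof.
apply: inj_card_bij => [[j s] [k u] /= e|]; last first.
  by rewrite card_prod card_ord !card_Sn factS.
have jk : j = k by rewrite -(lift_perm_id ord0 j s) e lift_perm_id.
congr (_, _) => //; apply/permP => i; apply: (@lift_inj _ j).
by rewrite -(lift_perm_lift ord0) e lift_perm_lift jk.
Qed.

Lemma sum_inversionsS (R : comNzRingType) (x : R) n :
  \sum_(s : 'S_n.+1) x ^+ inversions s =
  (\sum_(k < n.+1) x ^+ k) * \sum_(s : 'S_n) x ^+ inversions s.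
Proof.
rewrite (reindex _ (onW_bij _ (lift_perm_bij n))) /=.
rewrite -(pair_bigA _
  (fun (j : 'I_n.+1) s => x ^+ inversions (lift_perm ord0 j s))) /=.
rewrite mulr_suml; apply: eq_bigr => j _; rewrite mulr_sumr.
by apply: eq_bigr => s _; rewrite inversions_lift_perm exprD.
Qed.

(** * Squared norms of tensor powers *)

Definition qt_sqnorm {R : realType} (q t : R) (n : nat) : R :=
  t ^+ (n * n.-1)./2 * \sum_(s : 'S_n) (q / t) ^+ inversions s.

Lemma qt_number0 (R : realType) (q t : R) : qt_number q t 0 = 0.
Proof. by rewrite /qt_number !expr0 subrr mul0r. Qed.

(** With [qt_sqnorm0], this identifies [qt_sqnorm q t n] as the (q,t)-factorial. The extra power t^n
    turns the geometric sum in q/t into the (q,t)-number. *)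
Lemma qt_sqnormS (R : realType) (q t : R) n : t != 0 -> t != q ->
  qt_sqnorm q t n.+1 = qt_number q t n.+1 * qt_sqnorm q t n.
Proof.
move=> t0 tq; rewrite /qt_sqnorm sum_inversionsS.
have -> : ((n.+1 * n.+1.-1)./2 = n + (n * n.-1)./2)%N.
  case: n => [|n]; first by [].
  rewrite [n.+2.-1]/= [n.+1.-1]/=.
  have -> : (n.+2 * n.+1 = n.+1.*2 + n.+1 * n)%N by rewrite -addnn; ring.
  (* Halving splits over the sum without a carry, as one summand is even. *)
  by rewrite halfD odd_double doubleK.
have -> : qt_number q t n.+1 = t ^+ n * \sum_(k < n.+1) (q / t) ^+ k.
  rewrite /qt_number subrXX mulrC mulKf ?subr_eq0 // mulr_sumr.
  apply: eq_bigr => -[k kn] _ /=.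
  by rewrite expr_div_n mulrCA mulrC (expfB_cond _ (n := k)) // (negPf t0).
by rewrite exprD; ring.
Qed.

(* If [w] in the span is closer to [v] than [`|v|], then [v] being orthogonal
   to [w] gives [`|v|^2 + `|w|^2 = `|v - w|^2 < `|v|^2]. *)
Lemma dense_lin_span_orthogonal {R : realType}
    {V : completeNormedModType R[i]} (dot : {dot V for (@Num.conj R[i])})
    (S : set V) (v : V) :
  hilbert_norm dot -> dense (lin_span S) -> (forall u, S u -> dot v u = 0) ->
  v = 0.
Proof.
move=> hdot densS vS; apply/eqP; apply: contraT => v0.
have nv : 0 < `|v| by rewrite normr_gt0.
have [|w [vw [r rS wE]]] := densS (ball v `|v|) _ (ball_open v `|v|).
  by exists v; exact: ballxx.
have vw0 : dot v w = 0.
  rewrite wE linear_sumr big1_seq // => p /andP[_ pr].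
  by rewrite linearZr_LR /= vS ?mulr0 //; exact: rS.
have e : `|v - w| ^+ 2 = `|v| ^+ 2 + `|w| ^+ 2 by rewrite -!hdot hnormBd.
move: vw; rewrite -ball_normE /ball_ /= -(ltr_pXn2r (ltn0Sn 1)) ?nnegrE //.
by rewrite e gtrDl le_gtF // exprn_ge0.
Qed.

(** * The one-mode Fock space and the annihilation operator *)

Section OneModeFock.
Context {R : realType} {q t : R} {H : completeNormedModType R}.
Context {dotH : {dot H for idfun}} (F : qt_fock_space q t dotH) (xi : H).
Hypothesis hxi : dotH xi xi = 1.
Hypothesis hspan : forall h : H, exists a : R, h = a *: xi.

(** Reduces identities between vectors to inner products computable by [tensor_dot]: the difference
    is orthogonal to a set with dense span. *)
Lemma fock_ext (v w : F) :
  (forall s, fock_dot F v (tensor F s) = fock_dot F w (tensor F s)) -> v = w.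
Proof.
move=> e; apply/eqP; rewrite -subr_eq0; apply/eqP.
refine (dense_lin_span_orthogonal _ _ _
  (@fock_hilbert _ _ _ _ _ F) (@tensor_dense _ _ _ _ _ F) _).
by move=> _ [s _ <-]; rewrite linearBl /= e subrr.
Qed.

Lemma one_mode_dot (h k : H) : dotH h k = dotH h xi * dotH k xi.
Proof.
have [[a ->] [b ->]] := (hspan h, hspan k).
by rewrite !linearZl_LR !linearZr_LR /= hxi /GRing.scale /=; ring.
Qed.

(** In dimension one each permutation contributes the same product of coordinates, which therefore
    factors out of the sum. *)
Lemma one_mode_inner (s u : seq H) :
  qt_inner q t dotH s u = (size s == size u)%:R *
    (qt_sqnorm q t (size s) *
      ((\prod_(h <- s) dotH h xi) * \prod_(h <- u) dotH h xi)).
Proof.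
rewrite /qt_inner; have [e|_] := eqVneq; last by rewrite !mul0r.
rewrite !mul1r /qt_sqnorm -mulrA; congr (_ * _); rewrite mulr_suml.
apply: eq_bigr => sigma _; congr (_ * _).
rewrite (eq_bigr _ (fun (i : 'I_(size s)) _ => one_mode_dot s`_i u`_(sigma i))).
rewrite big_split /=; congr (_ * _).
  by rewrite [RHS](big_nth 0) big_mkord.
rewrite -(reindex_inj (P := xpredT) (F := fun k : 'I_(size s) => dotH u`_k xi)
              (@perm_inj _ sigma)) /=.
by rewrite [RHS](big_nth 0) big_mkord -e.
Qed.

Lemma prod_dot_nseq (n : nat) : \prod_(h <- nseq n xi) dotH h xi = 1.
Proof. by rewrite big_nseq hxi; elim: n => //= n ->; rewrite mulr1. Qed.

Local Notation T := (tensor_power F xi).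

Lemma tensor_power_dot (n : nat) (s : seq H) :
  fock_dot F (T n) (tensor F s) =
  ((n == size s)%:R * (qt_sqnorm q t n * \prod_(h <- s) dotH h xi))%:C.
Proof.
by rewrite tensor_dot one_mode_inner size_nseq prod_dot_nseq mul1r.
Qed.

(** Multilinearity of [tensor] is recovered here from inner products; it lets [Adag], specified on
    tensor powers, be evaluated on every elementary tensor. *)
Lemma tensor_one_mode (s : seq H) :
  tensor F s = (\prod_(h <- s) dotH h xi)%:C *: T (size s).
Proof.
apply: fock_ext => u; rewrite linearZl_LR /= tensor_power_dot tensor_dot.
by rewrite one_mode_inner -rmorphM /=; congr _%:C; ring.
Qed.

Variables Adag A : {linear F -> F}.
Hypothesis hAdag : is_creation xi Adag.
Hypothesis hA : is_adjoint Adag A.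

Lemma annihilation_tensor_power (n : nat) : t != 0 -> t != q ->
  A (T n) = (qt_number q t n)%:C *: T n.-1.
Proof.
move=> t0 tq; apply: fock_ext => s; rewrite hA linearZl_LR /= tensor_power_dot.
rewrite tensor_one_mode linearZ /= hAdag.2 linearZr_LR /=.
(* The second argument is conjugate-linear, but the scalar is real. *)
rewrite [X in X * _](conjc_real _).
rewrite tensor_power_dot size_nseq -!rmorphM /=; congr _%:C.
rewrite (prod_dot_nseq (size s).+1).
(* For [n = 0] both sides vanish: the degrees [0] and [(size s).+1] differ, and [0] = 0. *)
case: n => [|n]; first by rewrite qt_number0 !mul0r mulr0.
by rewrite eqSS qt_sqnormS //=; case: eqP => _; ring.
Qed.

End OneModeFock.

(** * Polynomials of an operator and the Charlier recurrence *)

Section PolyOp.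
Context {R : realType} {q t : R} {H : completeNormedModType R}.
Context {dotH : {dot H for idfun}} {F : qt_fock_space q t dotH}.

(** Gives polynomials of different sizes a common summation range. *)
Lemma poly_op_widen (P : {poly R[i]}) (T : F -> F) (x : F) (n : nat) :
  (size P <= n)%N -> poly_op P T x = \sum_(i < n) P`_i *: iter i T x.
Proof.
move=> Pn; rewrite /poly_op (big_ord_widen _ (fun i => P`_i *: iter i T x) Pn).
rewrite big_mkcond; apply: eq_bigr => i _; case: ltnP => // iP.
by rewrite nth_default // scale0r.
Qed.

Lemma poly_op_is_linear (T : F -> F) (x : F) :
  linear (fun P : {poly R[i]} => poly_op P T x).
Proof.
move=> a P Q; pose n := maxn (size P) (maxn (size Q) (size (a *: P + Q))).
rewrite !(@poly_op_widen _ _ _ n) ?leq_max ?leqnn ?orbT // scaler_sumr.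
rewrite -big_split; apply: eq_bigr => i _.
by rewrite /= coefD coefZ scalerDl scalerA.
Qed.

Lemma poly_opZ (a : R[i]) (P : {poly R[i]}) (T : F -> F) (x : F) :
  poly_op (a *: P) T x = a *: poly_op P T x.
Proof.
have op0 : poly_op 0 T x = 0 by rewrite /poly_op size_poly0 big_ord0.
by rewrite -[a *: P]addr0 poly_op_is_linear op0 addr0.
Qed.

Lemma poly_opD (P Q : {poly R[i]}) (T : F -> F) (x : F) :
  poly_op (P + Q) T x = poly_op P T x + poly_op Q T x.
Proof. by rewrite -[P]scale1r poly_op_is_linear !scale1r. Qed.

Lemma poly_opB (P Q : {poly R[i]}) (T : F -> F) (x : F) :
  poly_op (P - Q) T x = poly_op P T x - poly_op Q T x.
Proof. by rewrite -scaleN1r poly_opD poly_opZ scaleN1r. Qed.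

Lemma poly_op1 (T : F -> F) (x : F) : poly_op 1 T x = x.
Proof. by rewrite /poly_op size_poly1 big_ord1 coefC scale1r. Qed.

Lemma poly_opXM (P : {poly R[i]}) (T : {linear F -> F}) (x : F) :
  poly_op ('X * P) T x = T (poly_op P T x).
Proof.
rewrite (@poly_op_widen _ _ _ (size P).+1); last first.
  by rewrite (leq_trans (size_polyMleq _ _)) // size_polyX.
rewrite big_ord_recl coefXM scale0r add0r linear_sum.
by apply: eq_bigr => i _; rewrite coefXM linearZ.
Qed.

(** Supplies the linear structure that [poly_opXM] requires of the operator. *)
Lemma qt_poisson_op_is_linear (lam : R) (Adag A : {linear F -> F}) :
  linear (qt_poisson_op lam Adag A).
Proof.
move=> a x y; rewrite /qt_poisson_op /qt_number_op /= !linearP.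
rewrite !scalerDr !scalerA ![_ * a]mulrC -!scalerA.
rewrite [RHS]addrACA; congr (_ + _); rewrite [RHS]addrACA; congr (_ + _).
by rewrite addrACA.
Qed.

HB.instance Definition _ (lam : R) (Adag A : {linear F -> F}) :=
  GRing.isLinear.Build R[i] F F _
    (qt_poisson_op lam Adag A) (qt_poisson_op_is_linear lam Adag A).

Lemma qt_charlierSS (lam : R) (n : nat) :
  qt_charlier q t lam n.+2 =
  ('X - (lam + qt_number q t n.+1)%:P) * qt_charlier q t lam n.+1
  - (lam * qt_number q t n.+1) *: qt_charlier q t lam n.
Proof. by []. Qed.

Lemma charlier_poly_op (lam : R) (Adag A : {linear F -> F}) (xi : H) (n : nat) :
  0 <= lam -> is_creation xi Adag ->
  (forall k, A (tensor_power F xi k) =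
             (qt_number q t k)%:C *: tensor_power F xi k.-1) ->
  poly_op (map_poly (real_complex R) (qt_charlier q t lam n))
    (qt_poisson_op lam Adag A) (vacuum F)
  = (Num.sqrt lam ^+ n)%:C *: tensor_power F xi n.
Proof.
move=> lam0 [_ hAdag] hA; set p := qt_poisson_op lam Adag A.
pose s := Num.sqrt lam; have ss : lam = s * s by rewrite -expr2 sqr_sqrtr.
have pT k : p (tensor_power F xi k) =
    (lam + qt_number q t k)%:C *: tensor_power F xi k +
    s%:C *: tensor_power F xi k.+1 +
    (s * qt_number q t k)%:C *: tensor_power F xi k.-1.
  rewrite /p /qt_poisson_op /qt_number_op /= hAdag hA linearZ /= hAdag.
  rewrite scalerDr scalerA -rmorphM rmorphD scalerDl.
  (* At [k = 0], where [k.-1.+1] is not [k], the coefficient [0] vanishes. *)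
  rewrite (_ : _ *: tensor_power F xi k.-1.+1 =
               (qt_number q t k)%:C *: tensor_power F xi k).
    by rewrite [LHS]addrC !addrA.
  by case: k => // ; rewrite qt_number0 !scale0r.
have pZ (a : R[i]) x : p (a *: x) = a *: p x by rewrite /p linearZ.
have step (a : R) P :
    poly_op (map_poly (real_complex R) (('X - a%:P) * P)) p (vacuum F) =
    p (poly_op (map_poly (real_complex R) P) p (vacuum F)) -
    a%:C *: poly_op (map_poly (real_complex R) P) p (vacuum F).
  rewrite mulrBl mul_polyC rmorphB /= poly_opB rmorphM /= map_polyX poly_opXM.
  by rewrite map_polyZ poly_opZ.
elim/ltn_ind: n => -[_|[_|n IH]].
- by rewrite /= rmorph1 poly_op1 expr0 scale1r.
(* C_1 is read as (X - lam) * 1 so that [step] applies; the diagonal coefficient at the vacuum is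
   lam and cancels. *)
- rewrite -[qt_charlier _ _ _ _]mulr1 step rmorph1 poly_op1.
  rewrite (pT 0) qt_number0 !mulr0 addr0 scale0r addr0 addrAC subrr add0r.
  by rewrite expr1.
rewrite qt_charlierSS rmorphB /= poly_opB step map_polyZ poly_opZ.
rewrite (IH n.+1) // (IH n) // pZ pT !scalerDr !scalerA -!rmorphM /=.
rewrite -/s [(lam + _) * _]mulrC.
(* As lam = s^2, the C_n term of the recurrence cancels the lowering term of [pT]; only the raising
   term remains. *)
rewrite [lam * _ * _](_ : _ = s ^+ n.+1 * (s * qt_number q t n.+1)).
  by rewrite addrAC addrK addrAC subrr add0r -exprSr.
by rewrite ss exprS; ring.
Qed.

End PolyOp.

(** * Charlier polynomials as a basis *)

Lemma qt_charlier_monic {R : realType} (q t lam : R) (n : nat) :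
  qt_charlier q t lam n \is monic /\ size (qt_charlier q t lam n) = n.+1.
Proof.
elim/ltn_ind: n => -[_|[_|n IH]].
- by rewrite monic1 size_poly1.
- by rewrite monicXsubC size_XsubC.
have [[m1 s1] [_ s0]] := (IH n.+1 (ltnSn _), IH n (ltnW (ltnSn _))).
rewrite qt_charlierSS; set c := _ + qt_number _ _ _.
set d := _ * qt_number _ _ _.
have sM : size (('X - c%:P) * qt_charlier q t lam n.+1) = n.+3.
  by rewrite size_Mmonic ?polyXsubC_eq0 // size_XsubC s1.
have sN : (size (- (d *: qt_charlier q t lam n)) < n.+3)%N.
  by rewrite size_polyN (leq_ltn_trans (size_scale_leq _ _)) // s0.
rewrite size_polyDl ?sM //; split=> //.
by rewrite monicE lead_coefDl ?sM // -monicE monicMl // monicXsubC.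
Qed.

(** Spanning in the form of an induction principle: subtracting the leading coefficient times the
    monic C_m of the same degree lowers the size. *)
Lemma qt_charlier_ind {R : realType} (q t lam : R) (K : {poly R} -> Prop) :
  K 0 ->
  (forall n (a : R) (P : {poly R}),
     K P -> K (a *: qt_charlier q t lam n + P)) ->
  forall P, K P.
Proof.
move=> K0 KS P; have [n] := ubnP (size P); elim: n P => // n IH P sP.
have [->//|P0] := eqVneq P 0.
pose m := (size P).-1; pose C := qt_charlier q t lam m.
have [/monicP lC sC] := qt_charlier_monic q t lam m.
rewrite -(subrKC (lead_coef P *: C) P); apply: KS; apply: IH.
have mP : m.+1 = size P by rewrite prednK // size_poly_gt0.
apply: (@leq_trans m.+1); last by rewrite mP -ltnS.
rewrite ltnS.
apply/leq_sizeP => j; rewrite leq_eqVlt => /orP[/eqP<-|mj].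
  rewrite coefB coefZ lead_coefE -/m.
  by move: lC; rewrite lead_coefE sC -/C /= => ->; rewrite mulr1 subrr.
by rewrite coefB coefZ !nth_default ?mulr0 ?subrr -?mP ?sC.
Qed.

(** Reduces complex coefficients to real ones, matching the componentwise [complex_integral]. *)
Lemma poly_complexE (R : rcfType) (P : {poly R[i]}) :
  exists A B : {poly R},
    P = map_poly (real_complex R) A + 'i%C *: map_poly (real_complex R) B.
Proof.
exists (\poly_(k < size P) complex.Re P`_k),
  (\poly_(k < size P) complex.Im P`_k).
apply/polyP => k; rewrite coefD coefZ.
rewrite ![(map_poly (real_complex R) _)`_k]coef_map !coef_poly.
case: ltnP => [_|Pk]; first exact: complexE.
by rewrite nth_default //= mulr0 addr0.
Qed.

(** * Integrals of polynomials from finite moments *)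

Section Moments.
Context {R : realType} {mu : probability (measurableTypeR R) R}.
Hypothesis moments :
  forall n : nat, mu.-integrable setT (fun x : R => (x ^+ n)%:E).

Lemma integrable_horner (P : {poly R}) :
  mu.-integrable setT (fun x : R => P.[x]%:E).
Proof.
rewrite (_ : (fun _ => _) =
  (fun x : R => \sum_(i < size P) (P`_i)%:E * (x ^+ i)%:E)%E).
  by apply: integrable_sum => // i _; exact: integrableZl.
by apply/funext => x; rewrite horner_coef -sumEFin.
Qed.

Lemma Rintegral_hornerZD (a : R) (P Q : {poly R}) :
  \int[mu]_x (a *: P + Q).[x] = a * \int[mu]_x P.[x] + \int[mu]_x Q.[x].
Proof.
under eq_Rintegral => x _ do rewrite hornerD hornerZ.
have iP := integrable_horner P; have iQ := integrable_horner Q.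
rewrite RintegralD ?RintegralZl //.
exact: (integrableZl _ a iP).
Qed.

End Moments.

Lemma qt_sqnorm0 (R : realType) (q t : R) : qt_sqnorm q t 0 = 1.
Proof.
rewrite /qt_sqnorm expr0 mul1r (eq_bigr (fun=> 1)) => [|s _].
  by rewrite sumr_const card_Sn.
by rewrite inversionsE big_ord0 expr0.
Qed.

Theorem theorem3p8 (R : realType) (q t lam : R)
    (hq : -1 < q < 1) (hqt : `|q| < t) (ht : t <= 1) (hlam : 0 < lam)
    (H : completeNormedModType R) (dotH : {dot H for idfun})
    (hH : hilbert_norm dotH)
    (xi : H) (hxi : `|xi| = 1) (hspan : forall h : H, exists a : R, h = a *: xi)
    (F : qt_fock_space q t dotH)
    (Adag A : {linear F -> F})
    (hAdag : is_creation xi Adag) (hA : is_adjoint Adag A) :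
  (forall n : nat,
     poly_op (map_poly (real_complex R) (qt_charlier q t lam n))
       (qt_poisson_op lam Adag A) (vacuum F)
     = (Num.sqrt (lam ^+ n))%:C *: tensor_power F xi n) /\
  (forall mu : probability (measurableTypeR R) R,
     is_qt_poisson q t lam mu ->
     forall P : {poly R[i]},
       vacuum_expectation (poly_op P (qt_poisson_op lam Adag A))
       = complex_integral mu (fun x : R => P.[x%:C])).
Proof.
have [t0 tq] : t != 0 /\ t != q.
  have qt : q < t by rewrite (le_lt_trans (ler_norm q)).
  by rewrite gt_eqF ?(le_lt_trans (normr_ge0 q)) // gt_eqF.
have xi1 : dotH xi xi = 1 by rewrite hH hxi expr1n.
have lam0 := ltW hlam.
have charlier n := charlier_poly_op lam Adag A xi n lam0 hAdag
  (fun k => annihilation_tensor_power F xi xi1 hspan Adag A hAdag hA k t0 tq).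
split=> [n|mu [moments ortho] P].
  rewrite charlier; congr (_%:C *: _).
  by elim: n => [|n IH]; rewrite ?expr0 ?sqrtr1 // !exprS sqrtrM // IH.
set p := qt_poisson_op lam Adag A.
have expZD a (P1 P2 : {poly R[i]}) :
    vacuum_expectation (poly_op (a *: P1 + P2) p) =
    a * vacuum_expectation (poly_op P1 p) + vacuum_expectation (poly_op P2 p).
  by rewrite /vacuum_expectation poly_opD poly_opZ linearPl.
(* Both sides are linear in [B], so it suffices to compare them on the Charlier polynomials. *)
have real_expectation (B : {poly R}) :
    vacuum_expectation (poly_op (map_poly (real_complex R) B) p) =
    (\int[mu]_x B.[x])%:C.
  elim/(qt_charlier_ind q t lam): B => [|n a B IH].
    rewrite map_poly0 /vacuum_expectation /poly_op size_poly0 big_ord0 linear0l.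
    by under eq_Rintegral do rewrite horner0; rewrite Rintegral_cst // mul0r.
  rewrite rmorphD /= map_polyZ expZD IH Rintegral_hornerZD // rmorphD rmorphM.
  congr (_ * _ + _); rewrite /vacuum_expectation charlier linearZl_LR /=.
  (* The vacuum is the tensor of the empty sequence, so only [n = 0] gives a nonzero inner
     product. *)
  rewrite tensor_power_dot // big_nil mulr1.
  case: n => [|n].
    under eq_Rintegral do rewrite hornerC.
    have mu1 := congr1 fine (probability_setT mu).
    by rewrite Rintegral_cst // mu1 qt_sqnorm0 !mul1r.
  (* Since C_0 = 1, orthogonality to C_0 says that the integral of C_(n+1) is 0. *)
  have := ortho n.+1 0%N isT.
  by under eq_Rintegral do rewrite [X in _ * X]hornerC mulr1; rewrite -/qt_charlier => ->;
    rewrite mul0r mulr0.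
have [B1 [B2 ->]] := poly_complexE R P.
rewrite addrC expZD !real_expectation /complex_integral.
have eval_real (x : R) :
    ('i%C *: map_poly (real_complex R) B2 + map_poly (real_complex R) B1).[x%:C]
    = Complex B1.[x] B2.[x].
  by rewrite hornerD hornerZ !horner_map /= [RHS]complexE addrC.
transitivity (Complex (\int[mu]_x B1.[x]) (\int[mu]_x B2.[x])).
  by rewrite [RHS]complexE addrC.
by congr Complex; apply: eq_Rintegral => x _; rewrite eval_real.
Qed.
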